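(* Let $d,m\in\mathbb{N}$, $\mu\in\mathcal{M}$, $y\in\mathbb{T}^d$, and let $g\in\langle e^{2\pi i kx}: k\in[m]\rangle$ (complex linear span) be a trigonometric polynomial of max-degree $m$ such that $g(y)\neq0$ and $g$ vanishes on $\operatorname{supp}\mu$. Then for all $n\in\mathbb{N}$ with $n\ge m$, $$p_{1,n+m}(y)\le1-\frac{(n+1)^d}{(n+m+1)^d}\cdot\frac{|g(y)|^2}{(F_n*|g|^2)(y)}\le\frac{\|g\|_{L^2}^2}{|g(y)|^2}\,\frac{m(4m+2)^d}{n+1}+\frac{dm}{n+m+1}.$$
   Context: $\mathbb{N}=\{1,2,\dots\}$, $\mathbb{T}^d=[0,1)^d$ is the torus, $kx=k_1x_1+\dots+k_dx_d$, $[n]=\{0,\dots,n\}^d$. $\mathcal{M}$ is the set of complex Borel measures $\mu$ on $\mathbb{T}^d$ of finite total variation with $\mu(\mathbb{T}^d)=1$. With $\hat\mu(k)=\int_{\mathbb{T}^d}e^{-2\pi i kx}\,\mathrm{d}\mu(x)$, the moment matrix is $T_n=(\hat\mu(k-\ell))_{k,\ell\in[n]}\in\mathbb{C}^{N\times N}$, $N=(n+1)^d$, with singular value decomposition $T_n=U_n\Sigma_nV_n^*$ and singular values in non-increasing order. With $e_n(x)=(e^{-2\pi i kx})_{k\in[n]}$ and $u_j^{(n)}(x)$ the $j$-th entry of $e_n(x)^*U_n$, define $$p_{1,n}(x)=\frac{1}{(n+1)^d}\sum_{j=1}^{\operatorname{rank}T_n}|u_j^{(n)}(x)|^2.$$ The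 Fejér kernel is $F_n(x)=\sum_{k=-n}^n\left(1-\frac{|k|}{n+1}\right)e^{2\pi i kx}$ for $x\in\mathbb{T}$ and $F_n(x_1,\dots,x_d)=F_n(x_1)\cdots F_n(x_d)$ on $\mathbb{T}^d$; $(F_n*f)(y)=\int_{\mathbb{T}^d}F_n(y-z)f(z)\,\mathrm{d}z$. *)

(* Defs.v *)
From HB Require Import structures.
From mathcomp Require Import all_boot all_order all_algebra.
From mathcomp Require Import sesquilinear spectral complex.
From mathcomp Require Import all_classical all_reals all_analysis.
From mathcomp Require Import measurable_realfun.

Set Implicit Arguments.
Unset Strict Implicit.
Unset Printing Implicit Defensive.

Import Order.TTheory GRing.Theory Num.Theory.
Import numFieldNormedType.Exports.

Local Open Scope classical_set_scope.
Local Open Scope ring_scope.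
Local Open Scope complex_scope.
Local Open Scope sesquilinear_scope.

Section circle.
Variable R : realType.

Record circle := Circle { cval : R ; cvalP : (0 <= cval) && (cval < 1) }.

HB.instance Definition _ := [isSub for cval].
HB.instance Definition _ := [Choice of circle by <:].

Fact circle0_subproof : ((0 : R) <= 0) && ((0 : R) < 1).
Proof. by rewrite lexx ltr01. Qed.

HB.instance Definition _ := isPointed.Build circle (Circle circle0_subproof).

(* Borel sets of [0,1): the traces of the Borel sets of the line. They are also
   the Borel sets of the quotient topology of R/Z. *)
HB.instance Definition _ :=
  Measurable.copy circle (g_sigma_algebra_preimageType cval).

Fact to_circle_subproof (t : R) :
  (0 <= t - (Num.floor t)%:~R) && (t - (Num.floor t)%:~R < 1).
Proof.
have /andP[h1 h2] := floor_itv t.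
by rewrite subr_ge0 h1 /= ltrBlDl -[1]/(1%:~R) -intrD.
Qed.

Definition to_circle (t : measurableTypeR R) : circle :=
  Circle (to_circle_subproof t).

Fact measurable_to_circle : measurable_fun [set: measurableTypeR R] to_circle.
Proof.
move=> _ A [B mB <-]; rewrite !setTI.
have mf : measurable_fun [set: R] (fun x : R => x - (Num.floor x)%:~R).
  apply: measurable_funB => //.
  apply: nondecreasing_measurable => // s t st.
  by rewrite ler_int; exact: le_floor.
by rewrite -[X in measurable X]setTI; exact: mf.
Qed.

HB.instance Definition _ :=
  isMeasurableFun.Build _ _ (measurableTypeR R) circle to_circle measurable_to_circle.

(* The uniform law on [0, 1] is the Lebesgue measure restricted to [0, 1]. *)
Definition circle_lebesgue : probability circle R :=
  distribution (uniform_prob (@ltr01 R)) to_circle.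

Definition circle_dist (s t : circle) : R :=
  Num.min `|cval s - cval t| (1 - `|cval s - cval t|).

End circle.

(* The d-fold product, with the product sigma-algebra of the library on tuples;
   `torus_ball` gives the neighbourhoods of the quotient topology of R^d/Z^d. *)
Section torus.
Variable R : realType.

Definition torus (d : nat) := d.-tuple (circle R).

HB.instance Definition _ d := Measurable.on (torus d).

Definition torus_sub d (x y : torus d) : torus d :=
  [tuple to_circle (cval (tnth x i) - cval (tnth y i)) | i < d].

Definition torus_ball d (x : torus d) (e : R) : set (torus d) :=
  [set z | forall i, circle_dist (tnth x i) (tnth z i) < e].

Definition torus_cons d (p : circle R * torus d) : torus d.+1 :=
  [tuple of p.1 :: p.2].

Fact measurable_torus_cons d :
  measurable_fun [set: circle R * torus d] (@torus_cons d).
Proof. exact: measurable_cons. Qed.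

HB.instance Definition _ d :=
  isMeasurableFun.Build _ _ _ _ (@torus_cons d) (@measurable_torus_cons d).

Fixpoint torus_lebesgue d : probability (torus d) R :=
  if d is d'.+1 then
    distribution (circle_lebesgue R \x torus_lebesgue d')%E (@torus_cons d')
  else \d_([tuple] : torus 0).

End torus.

(* A complex measure is given by its real and imaginary parts, which are finite
   signed measures. *)
Section complex_measure.
Context d (T : measurableType d) (R : realType).

Record complex_measure := ComplexMeasure {
  cm_re : {charge set T -> \bar R} ;
  cm_im : {charge set T -> \bar R} }.

Definition cm_val (mu : complex_measure) (A : set T) : R[i] :=
  fine (cm_re mu A) +i* fine (cm_im mu A).

Coercion cm_val : complex_measure >-> Funclass.

Definition total_variation (mu : complex_measure) (A : set T) : \bar R :=
  ereal_sup [set (\sum_(0 <= k <oo) (Normc.normc (mu (F k)))%:E)%E | F in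
    [set F : (set T)^nat | [/\ forall k, measurable (F k), trivIset setT F &
                              \bigcup_k F k = A]]].

Definition integral_measure (m : {measure set T -> \bar R}) (f : T -> R[i]) :
    R[i] :=
  (\int[m]_x complex.Re (f x)) +i* (\int[m]_x complex.Im (f x)).

Fact hahn_sig (nu : {charge set T -> \bar R}) :
  {PN : set T * set T | hahn_decomposition nu PN.1 PN.2}.
Proof.
by apply: cid; have [P [N h]] := Hahn_decomposition nu; exists (P, N).
Qed.

(* The Jordan parts do not depend on the chosen Hahn decomposition. *)
Definition integral_charge (nu : {charge set T -> \bar R}) (f : T -> R[i]) :
    R[i] :=
  let nuPN := svalP (hahn_sig nu) in
  integral_measure (jordan_pos nuPN) f - integral_measure (jordan_neg nuPN) f.

Definition integral_cm (mu : complex_measure) (f : T -> R[i]) : R[i] :=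
  integral_charge (cm_re mu) f + 'i%C * integral_charge (cm_im mu) f.

End complex_measure.

Section torus_measures.
Variables (R : realType) (d : nat).

Definition in_calM (mu : complex_measure (torus R d) R) : Prop :=
  (total_variation mu setT < +oo)%E /\ mu setT = 1.

Definition cm_supp (mu : complex_measure (torus R d) R) : set (torus R d) :=
  [set x | forall e, 0 < e -> (0 < total_variation mu (torus_ball x e))%E].

Definition cexpi (t : R) : R[i] := cos t +i* sin t.

(* exp (2 pi i kx) *)
Definition texp (k : 'I_d -> int) (x : torus R d) : R[i] :=
  cexpi (2 * pi * \sum_(i < d) (k i)%:~R * cval (tnth x i)).

Definition fourier_coef (mu : complex_measure (torus R d) R)
    (k : 'I_d -> int) : R[i] :=
  integral_cm mu (texp (fun i => - k i)).

Definition mindex (n : nat) := {ffun 'I_d -> 'I_n.+1}.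

Definition mindex_int n (k : mindex n) : 'I_d -> int := fun i => (k i)%:Z.

(* N = (n + 1)^d ; matrices over [n] are indexed through the enumeration of
   multi-indices. *)
Definition msize (n : nat) : nat := #|{: mindex n}|.

Definition moment_mx (mu : complex_measure (torus R d) R) (n : nat) :
    'M[R[i]]_(msize n) :=
  \matrix_(a, b) fourier_coef mu
    (fun i => mindex_int (enum_val a) i - mindex_int (enum_val b) i).

Definition evec (n : nat) (x : torus R d) : 'cV[R[i]]_(msize n) :=
  \col_a texp (fun i => - mindex_int (enum_val a) i) x.

Definition p1 (mu : complex_measure (torus R d) R) (n : nat)
    (U : 'M[R[i]]_(msize n)) (x : torus R d) : R[i] :=
  ((n.+1 ^ d)%:R)^-1 *
  \sum_(j < msize n | (j < \rank (moment_mx mu n))%N)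
     `| ((evec n x)^t* *m U) 0 j | ^+ 2.

Definition trig_poly (m : nat) (g : torus R d -> R[i]) : Prop :=
  exists c : mindex m -> R[i],
    forall x, g x = \sum_(k : mindex m) c k * texp (mindex_int k) x.

End torus_measures.

Definition is_svd (R : realType) (N : nat) (A U : 'M[R[i]]_N) (s : 'rV[R]_N)
    (V : 'M[R[i]]_N) : Prop :=
  [/\ U \is unitarymx, V \is unitarymx,
      forall j, 0 <= s 0 j,
      forall i j : 'I_N, (i <= j)%N -> s 0 j <= s 0 i &
      A = U *m diag_mx (map_mx (real_complex R) s) *m V^t* ].

Section fejer.
Variable R : realType.

Definition fejer1 (n : nat) (t : circle R) : R[i] :=
  \sum_(j < (2 * n).+1)
    let k := j%:Z - n%:Z in
    (1 - `|k|%:~R / n.+1%:R) * cexpi (2 * pi * (k%:~R * cval t)).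

Definition fejer (d n : nat) (x : torus R d) : R[i] :=
  \prod_(i < d) fejer1 n (tnth x i).

Definition torus_conv (d : nat) (F f : torus R d -> R[i]) (y : torus R d) :
    R[i] :=
  integral_measure (torus_lebesgue R d) (fun z => F (torus_sub y z) * f z).

Definition L2norm (d : nat) (f : torus R d -> R[i]) : R :=
  Num.sqrt (\int[torus_lebesgue R d]_x (Normc.normc (f x)) ^+ 2).

End fejer.

(* Main.v *)
Require Import Defs.
From HB Require Import structures.
From mathcomp Require Import all_boot all_order all_algebra.
From mathcomp Require Import sesquilinear spectral complex.
From mathcomp Require Import all_classical all_reals all_analysis.
From mathcomp Require Import measurable_realfun ring lra zify.

Set Implicit Arguments.
Unset Strict Implicit.
Unset Printing Implicit Defensive.

Import Order.TTheory GRing.Theory Num.Theory.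
Import numFieldNormedType.Exports.

Local Open Scope classical_set_scope.
Local Open Scope ring_scope.
Local Open Scope complex_scope.

(* Let p = sum_k c_k e(kx) have max-degree N and vanish on supp mu. Its
   coefficient vector c satisfies c^* T_N = int conj(p) e_N^* dmu = 0, so U^* c
   vanishes in the first rank T_N coordinates, and Cauchy-Schwarz applied to
   p(y) = (e_N(y)^* U)(U^* c) gives (N+1)^d (1 - p_{1,N}(y)) >= |p(y)|^2/|c|^2,
   where |c| is the L^2 norm of p.
   The first inequality is the case N = n + m, p = g q, with the Dirichlet
   polynomial q(x) = sum_{k in [n]} e(k(x - y)): here q(y) = (n+1)^d and
   |q(z)|^2 = (n+1)^d F_n(y - z), so |c|^2 = (n+1)^d (F_n * |g|^2)(y).
   For the second one write g = sum_k c_k e(kx); then F_n * |g|^2 - |g|^2 is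
   sum_{k,l} c_k conj(c_l) (prod_i (1 - |k_i - l_i|/(n+1)) - 1) e((k-l)x), which
   is at most dm/(n+1) (sum_k |c_k|)^2 <= dm/(n+1) (m+1)^d |g|_2^2 in modulus,
   and Bernoulli's inequality bounds 1 - ((n+1)/(n+m+1))^d. *)

(** * Integration of bounded measurable complex functions *)

Section bounded_measurable.
Context d (T : measurableType d) (R : realType).
Implicit Types f g : T -> R[i].

(** This class is stable under sums, products and conjugation, and its members are integrable for
    every finite measure, so linearity of the integral needs no separate integrability proofs. *)
Definition bounded_mfun f :=
  [/\ measurable_fun setT (fun x => complex.Re (f x)),
      measurable_fun setT (fun x => complex.Im (f x)) &
      exists M : R, forall x, `|f x| <= M%:C].

Lemma normc_Re_le (z : R[i]) (M : R) : `|z| <= M%:C -> `|complex.Re z| <= M.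
Proof. by move=> h; rewrite -lecR (le_trans (normc_ge_Re z)). Qed.

(** Multiplication by ['i] turns the imaginary part into a real part, up to sign, and keeps the
    modulus. *)
Lemma normc_Im_le (z : R[i]) (M : R) : `|z| <= M%:C -> `|complex.Im z| <= M.
Proof.
move=> h; rewrite -[complex.Im z]opprK normrN -ReiNIm; apply: normc_Re_le.
by rewrite normrM complexiE normCi mulr1.
Qed.

Lemma bounded_mfun_cst c : bounded_mfun (fun=> c).
Proof.
split; [exact: measurable_cst|exact: measurable_cst|].
by exists (complex.Re `|c|); move=> _; rewrite RRe_real ?normr_real.
Qed.

Lemma bounded_mfunD f g :
  bounded_mfun f -> bounded_mfun g -> bounded_mfun (fun x => f x + g x).
Proof.
move=> [f1 f2 [M fM]] [g1 g2 [N gN]]; split.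
- rewrite [X in measurable_fun _ X](_ : _ =
    (fun x => complex.Re (f x)) \+ (fun x => complex.Re (g x))).
    exact: measurable_funD.
  by apply/funext => x /=; case: (f x) (g x) => [? ?] [].
- rewrite [X in measurable_fun _ X](_ : _ =
    (fun x => complex.Im (f x)) \+ (fun x => complex.Im (g x))).
    exact: measurable_funD.
  by apply/funext => x /=; case: (f x) (g x) => [? ?] [].
- exists (M + N) => x; rewrite rmorphD/=.
  by rewrite (le_trans (ler_normD _ _))// lerD.
Qed.

Lemma bounded_mfunM f g :
  bounded_mfun f -> bounded_mfun g -> bounded_mfun (fun x => f x * g x).
Proof.
move=> [f1 f2 [M fM]] [g1 g2 [N gN]]; split.
- rewrite [X in measurable_fun _ X](_ : _ =
    (fun x => complex.Re (f x)) \* (fun x => complex.Re (g x)) \-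
    (fun x => complex.Im (f x)) \* (fun x => complex.Im (g x))).
    by apply: measurable_funB; exact: measurable_funM.
  by apply/funext => x /=; case: (f x) (g x) => [? ?] [].
- rewrite [X in measurable_fun _ X](_ : _ =
    (fun x => complex.Re (f x)) \* (fun x => complex.Im (g x)) \+
    (fun x => complex.Im (f x)) \* (fun x => complex.Re (g x))).
    by apply: measurable_funD; exact: measurable_funM.
  by apply/funext => x /=; case: (f x) (g x) => [? ?] [].
- exists (M * N) => x; rewrite rmorphM/= normrM.
  by rewrite ler_pM.
Qed.

Lemma bounded_mfun_conj f :
  bounded_mfun f -> bounded_mfun (fun x => Num.conj (f x)).
Proof.
move=> [f1 f2 [M fM]]; split.
- rewrite [X in measurable_fun _ X](_ : _ = (fun x => complex.Re (f x)))//.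
  by apply/funext => x /=; case: (f x).
- rewrite [X in measurable_fun _ X](_ : _ = \- (fun x => complex.Im (f x))).
    by apply: measurableT_comp.
  by apply/funext => x /=; case: (f x).
- by exists M => x; rewrite norm_conjC.
Qed.

Lemma bounded_mfun_sum (I : Type) (s : seq I) (P : pred I)
    (F : I -> T -> R[i]) :
  (forall i, bounded_mfun (F i)) ->
  bounded_mfun (fun x => \sum_(i <- s | P i) F i x).
Proof.
move=> h; elim: s => [|i s ih].
  rewrite [X in bounded_mfun X](_ : _ = fun=> 0); first exact: bounded_mfun_cst.
  by apply/funext => x; rewrite big_nil.
rewrite [X in bounded_mfun X](_ : _ = fun x =>
  (if P i then F i x else 0) + \sum_(j <- s | P j) F j x).
  apply: bounded_mfunD => //; case: (P i) => //; exact: bounded_mfun_cst.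
by apply/funext => x; rewrite big_cons; case: (P i) => //; rewrite add0r.
Qed.

Lemma bounded_mfun_prod (I : Type) (s : seq I) (P : pred I)
    (F : I -> T -> R[i]) :
  (forall i, bounded_mfun (F i)) ->
  bounded_mfun (fun x => \prod_(i <- s | P i) F i x).
Proof.
move=> h; elim: s => [|i s ih].
  rewrite [X in bounded_mfun X](_ : _ = fun=> 1); first exact: bounded_mfun_cst.
  by apply/funext => x; rewrite big_nil.
rewrite [X in bounded_mfun X](_ : _ = fun x =>
  (if P i then F i x else 1) * \prod_(j <- s | P j) F j x).
  apply: bounded_mfunM => //; case: (P i) => //; exact: bounded_mfun_cst.
by apply/funext => x; rewrite big_cons; case: (P i) => //; rewrite mul1r.
Qed.

Variable m : {finite_measure set T -> \bar R}.

Lemma integrable_bounded (h : T -> R) M : measurable_fun setT h ->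
  (forall x, `|h x| <= M) -> m.-integrable setT (EFin \o h).
Proof.
move=> mh hM; apply: measurable_bounded_integrable => //.
- by rewrite ltey_eq fin_num_measure.
- exists M; split; first exact: num_real.
  by move=> N MN x _; exact: (le_trans (hM x) (ltW MN)).
Qed.

Lemma integrable_Re f : bounded_mfun f ->
  m.-integrable setT (EFin \o (fun x => complex.Re (f x))).
Proof.
move=> [f1 f2 [M fM]]; apply: (@integrable_bounded _ M) => // x.
exact: normc_Re_le.
Qed.

Lemma integrable_Im f : bounded_mfun f ->
  m.-integrable setT (EFin \o (fun x => complex.Im (f x))).
Proof.
move=> [f1 f2 [M fM]]; apply: (@integrable_bounded _ M) => // x.
exact: normc_Im_le.
Qed.

Lemma integral_measureD f g : bounded_mfun f -> bounded_mfun g ->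
  integral_measure m (fun x => f x + g x) =
  integral_measure m f + integral_measure m g.
Proof.
move=> bf bg; apply/eqP; rewrite eq_complex /=; apply/andP; split; apply/eqP.
- rewrite -RintegralD//; [|exact: integrable_Re|exact: integrable_Re].
  by apply: eq_Rintegral => x _; case: (f x) (g x) => [? ?] [].
- rewrite -RintegralD//; [|exact: integrable_Im|exact: integrable_Im].
  by apply: eq_Rintegral => x _; case: (f x) (g x) => [? ?] [].
Qed.

Lemma integral_measureZ c f : bounded_mfun f ->
  integral_measure m (fun x => c * f x) = c * integral_measure m f.
Proof.
case: c => a b bf; have ir := integrable_Re bf; have ii := integrable_Im bf.
have zr t := integrableZl measurableT t ir.
have zi t := integrableZl measurableT t ii.
apply/eqP; rewrite eq_complex /=; apply/andP; split; apply/eqP.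
- transitivity (\int[m]_x (a * complex.Re (f x)) -
    \int[m]_x (b * complex.Im (f x))); last by rewrite !RintegralZl.
  by rewrite -RintegralB;
    [apply: eq_Rintegral => x _; case: (f x)|by []|exact: zr|exact: zi].
- transitivity (\int[m]_x (a * complex.Im (f x)) +
    \int[m]_x (b * complex.Re (f x))); last by rewrite !RintegralZl.
  by rewrite -RintegralD;
    [apply: eq_Rintegral => x _; case: (f x)|by []|exact: zi|exact: zr].
Qed.

Lemma integral_measure_sum (I : Type) (s : seq I) (P : pred I)
    (c : I -> R[i]) (F : I -> T -> R[i]) :
  (forall i, bounded_mfun (F i)) ->
  integral_measure m (fun x => \sum_(i <- s | P i) c i * F i x) =
  \sum_(i <- s | P i) c i * integral_measure m (F i).
Proof.
move=> bF; have bcF i : bounded_mfun (fun x => c i * F i x).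
  by apply: bounded_mfunM => //; exact: bounded_mfun_cst.
elim: s => [|i s ih].
  have b0 := bounded_mfun_cst 0.
  rewrite big_nil -[RHS](mul0r (integral_measure m (fun=> 0)))
    -integral_measureZ//.
  by congr integral_measure; apply/funext => x; rewrite big_nil mul0r.
rewrite big_cons; case Pi: (P i); last first.
  by rewrite -ih; congr integral_measure; apply/funext => x;
    rewrite big_cons Pi.
have bs := bounded_mfun_sum s P bcF.
rewrite -ih -integral_measureZ// -integral_measureD//.
by congr integral_measure; apply/funext => x; rewrite big_cons Pi.
Qed.

Lemma integral_measure_null f (A : set T) : bounded_mfun f ->
  measurable A -> m A = 0%E -> (forall x, ~ A x -> f x = 0) ->
  integral_measure m f = 0.
Proof.
move=> bf mA A0 f0; apply/eqP; rewrite eq_complex /=.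
have key (h : T -> R) : m.-integrable setT (EFin \o h) ->
    (forall x, ~ A x -> h x = 0) -> \int[m]_x h x = 0.
  move=> ih h0; rewrite /Rintegral (negligible_integral mA measurableT ih A0).
  rewrite integral0_eq// => x [_ /=].
  by move=> /h0 ->.
by apply/andP; split; apply/eqP; apply: key;
  [exact: integrable_Re|move=> x /f0 ->|exact: integrable_Im|move=> x /f0 ->].
Qed.

End bounded_measurable.

Lemma bounded_mfun_comp d1 d2 (T1 : measurableType d1) (T2 : measurableType d2)
    (R : realType) (phi : T1 -> T2) (f : T2 -> R[i]) :
  measurable_fun setT phi -> bounded_mfun f -> bounded_mfun (f \o phi).
Proof.
move=> mphi [f1 f2 [M fM]]; split.
- exact: (measurableT_comp f1 mphi).
- exact: (measurableT_comp f2 mphi).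
- by exists M => x /=.
Qed.

Section complex_measure_integral.
Context d (T : measurableType d) (R : realType) (mu : complex_measure T R).

Lemma integral_cm_sum (I : Type) (s : seq I) (P : pred I)
    (c : I -> R[i]) (F : I -> T -> R[i]) :
  (forall i, bounded_mfun (F i)) ->
  integral_cm mu (fun x => \sum_(i <- s | P i) c i * F i x) =
  \sum_(i <- s | P i) c i * integral_cm mu (F i).
Proof.
move=> bF; rewrite /integral_cm /integral_charge !integral_measure_sum//.
rewrite -!sumrB mulr_sumr -big_split; apply: eq_bigr => i _ /=.
by rewrite !mulrBr; ring.
Qed.

End complex_measure_integral.

(** * The support of a complex measure *)

Section null_sets.
Context d (T : measurableType d) (R : realType) (mu : complex_measure T R).

(** The modulus of [mu B] is one term of the sum attached to a partition of [A] containing [B],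
    hence at most the total variation of [A]. *)
Lemma total_variation_le0 (A B : set T) :
  measurable A -> measurable B -> B `<=` A ->
  (Defs.total_variation mu A <= 0)%E ->
  cm_re mu B = 0%E /\ cm_im mu B = 0%E.
Proof.
move=> mA mB BA tv0.
have normB : Normc.normc (mu B) <= 0.
  rewrite -lee_fin (le_trans _ tv0)//.
  (* The partition is [B], then its complement in [A], then empty sets. *)
  pose F := bigcup2 B (A `\` B).
  have mF k : measurable (F k).
    by case: k => [|[|k]] /=; [exact: mB|exact: measurableD|exact: measurable0].
  have nF (k : nat) : (0 <= (Normc.normc (mu (F k)))%:E)%E.
    by rewrite lee_fin; case: (mu (F k)) => a b /=; exact: sqrtr_ge0.
  apply: (@le_trans _ _ (\sum_(0 <= k <oo) (Normc.normc (mu (F k)))%:E)%E).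
    apply: le_trans (nneseries_lim_ge 1 _); last by move=> k _ _; exact: nF.
    by rewrite big_nat1.
  apply: ereal_sup_ubound; exists F => //; split => //.
  - by rewrite -trivIset_bigcup2 setDE setIC -setIA setICl setI0.
  - by rewrite bigcup2E setDUK.
have /Normc.eq0_normc muB : Normc.normc (mu B) = 0.
  apply/eqP; rewrite eq_le normB/=.
  by case: (mu B) => a b /=; exact: sqrtr_ge0.
case: muB => re0 im0; split.
- by rewrite -[LHS]fineK ?re0// fin_num_measure.
- by rewrite -[LHS]fineK ?im0// fin_num_measure.
Qed.

End null_sets.

Section torus_topology.
Variables (R : realType) (d : nat).
Implicit Types (x z : torus R d).

Lemma measurable_cval : measurable_fun [set: circle R] (@cval R).
Proof. by move=> _ A mA; rewrite setTI; exists A => //; rewrite setTI. Qed.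

Lemma measurable_coord (i : 'I_d) :
  measurable_fun [set: torus R d] (fun z : torus R d => cval (tnth z i)).
Proof.
exact: (@measurableT_comp _ _ _ _ _ _ _ _ _
  measurable_cval (measurable_tnth i)).
Qed.

Lemma measurable_box (P : 'I_d -> set R) (F : 'I_d -> torus R d -> R) :
  (forall i, measurable (P i)) -> (forall i, measurable_fun setT (F i)) ->
  measurable [set z : torus R d | forall i, P i (F i z)].
Proof.
move=> mP mF.
rewrite (_ : [set z | _] = \bigcap_(i in [set: 'I_d]) (F i @^-1` P i)).
  apply: fin_bigcap_measurable; [exact: finite_finset|].
  by move=> i _; rewrite -[X in measurable X]setTI; exact: mF.
by apply/seteqP; split => z /= h i //=; exact: h.
Qed.

Lemma measurable_torus_ball x (e : R) : measurable (torus_ball x e).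
Proof.
rewrite (_ : torus_ball x e = [set z | forall i, `]-oo, e[%classic
    ((fun z => circle_dist (tnth x i) (tnth z i)) z)]).
  apply: (@measurable_box (fun=> `]-oo, e[%classic)
    (fun i z => circle_dist (tnth x i) (tnth z i))) => // i.
  have mn : measurable_fun setT
      (fun z : torus R d => `|cval (tnth x i) - cval (tnth z i)|).
    apply: measurableT_comp => //; apply: measurable_funB => //.
    exact: measurable_coord.
  by apply: measurable_minr => //; exact: measurable_funB.
by apply/seteqP; split => z /= h i; have := h i; rewrite /= in_itv.
Qed.

(* Countably many boxes, of the grids of mesh 1/(K+1), refine all the balls. *)
Lemma locally_null_set0 (m : {measure set (torus R d) -> \bar R})
    (O : set (torus R d)) :
  measurable O ->
  (forall x, O x -> exists2 e, 0 < e & forall B : set (torus R d),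
     measurable B -> B `<=` torus_ball x e -> m B = 0%E) ->
  m O = 0%E.
Proof.
move=> mO locO.
pose cell (K k : nat) : set R := `[k%:R / K.+1%:R, k.+1%:R / K.+1%:R[%classic.
pose box (q : nat * {ffun 'I_d -> nat}) : set (torus R d) :=
  [set z | forall i, cell q.1 (q.2 i) (cval (tnth z i))].
(* Boxes of positive measure are replaced by the empty set, so the union of all [nbox j] is
   negligible; it remains to put each point of [O] in a null box. *)
pose nbox (j : nat) : set (torus R d) :=
  if unpickle j is Some q then if m (box q) == 0%E then box q else set0
  else set0.
have mbox q : measurable (box q).
  apply: (@measurable_box (fun i => cell q.1 (q.2 i))
    (fun i z => cval (tnth z i))) => i; first exact: measurable_itv.
  exact: measurable_coord.
apply: measure_negligible => //.
apply: (@negligibleS _ _ _ _ (\bigcup_j nbox j)); last first.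
  apply: negligible_bigcup => j; rewrite /nbox.
  case: unpickle => [q|]; last exact: negligible_set0.
  case: ifPn => [/eqP q0|_]; last exact: negligible_set0.
  by apply/negligibleP.
move=> x Ox; have [e e0 nulle] := locO x Ox.
have [K Ke] : exists K : nat, K.+1%:R^-1 < e.
  by have [K _ KP] := near_infty_natSinv_lt (PosNum e0); exists K;
    exact: KP (leqnn K).
have K0 : 0 < K.+1%:R :> R by rewrite ltr0n.
(* The integer part of (K+1) x_i selects the cell of mesh 1/(K+1) < e that contains the coordinate
   x_i. *)
pose k : {ffun 'I_d -> nat} :=
  [ffun i => Num.trunc (K.+1%:R * cval (tnth x i))].
have xbox : box (K, k) x.
  move=> i; rewrite /cell /= in_itv /= ffunE.
  have x0 : 0 <= cval (tnth x i) by have /andP[] := cvalP (tnth x i).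
  have /andP[h1 h2] := truncn_itv (mulr_ge0 (ltW K0) x0).
  by rewrite ler_pdivrMr// ltr_pdivlMr// [cval _ * _]mulrC h1.
exists (pickle (K, k)) => //; rewrite /nbox pickleK ifT//.
apply/eqP; apply: nulle => // z zbox i.
have := xbox i; have := zbox i; rewrite /cell /= !in_itv /=.
move=> /andP[z1 z2] /andP[x1 x2].
(* The circle distance is at most the ordinary distance, and two points of one cell are closer than
   the mesh. *)
rewrite /circle_dist gt_min; apply/orP; left.
apply: lt_trans Ke.
have dist (a b c w : R) : c <= a -> a < c + w -> c <= b -> b < c + w ->
    `|a - b| < w.
  by move=> *; rewrite ltr_norml; apply/andP; split; lra.
apply: (dist _ _ ((k i)%:R / K.+1%:R)) => //.
  by rewrite -{2}[_^-1]mul1r -mulrDl natr1.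
by rewrite -{2}[_^-1]mul1r -mulrDl natr1.
Qed.

Variable mu : complex_measure (torus R d) R.

(** A point where [f] is nonzero lies off the support, so some ball around it has zero total
    variation. By [locally_null_set0] the set [O] of these points is null for all four Jordan parts,
    and [f] vanishes outside it. *)
Lemma integral_cm_supp (f : torus R d -> R[i]) :
  bounded_mfun f -> (forall x, cm_supp mu x -> f x = 0) -> integral_cm mu f = 0.
Proof.
move=> bf f0; pose O := [set x | f x != 0].
have mO : measurable O.
  have [f1 f2 _] := bf.
  rewrite (_ : O = (fun x => complex.Re (f x)) @^-1` (~` [set 0]) `|`
                   (fun x => complex.Im (f x)) @^-1` (~` [set 0])).
    apply: measurableU; rewrite -[X in measurable X]setTI.
      by apply: f1 => //; exact: measurableC.
    by apply: f2 => //; exact: measurableC.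
  apply/seteqP; split => x /=; rewrite /O /= eq_complex /= negb_and.
    by move=> /orP[]/eqP; [left|right].
  by move=> [/eqP->//|/eqP->]; rewrite orbT.
have locO x : O x -> exists2 e,
    0 < e & (Defs.total_variation mu (torus_ball x e) <= 0)%E.
  move=> /eqP fx; apply: contrapT => h; apply: fx; apply: f0 => e e0.
  by rewrite ltNge; apply/negP => tv; apply: h; exists e.
have null (nu : {charge set (torus R d) -> \bar R}) :
    (forall x e (B : set (torus R d)),
      (Defs.total_variation mu (torus_ball x e) <= 0)%E ->
      measurable B -> B `<=` torus_ball x e -> nu B = 0%E) ->
    integral_charge nu f = 0.
  move=> nuB; rewrite /integral_charge; move: (svalP (hahn_sig nu)) => /=.
  case: (sval (hahn_sig nu)) => P N /= PN.
  have outO x : ~ O x -> f x = 0 by move=> /negP/negPn/eqP.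
  have [[mP _] [mN _] _ _] := PN.
  have pos0 : jordan_pos PN O = 0%E.
    apply: locally_null_set0 => // x /locO[e e0 tv]; exists e => // B mB Be.
    (* The positive part of [B] is the value of [nu] on the intersection of [B] with [P], again a
       measurable subset of the ball; the negative part uses [N] and a sign. *)
    rewrite -[LHS]/(jordan_pos PN B) jordan_posE cjordan_posE /crestr0
      mem_set// /crestr.
    by rewrite (nuB x e) //; [exact: measurableI|move=> z [/Be]].
  have neg0 : jordan_neg PN O = 0%E.
    apply: locally_null_set0 => // x /locO[e e0 tv]; exists e => // B mB Be.
    rewrite -[LHS]/(jordan_neg PN B) jordan_negE cjordan_negE /crestr0
      mem_set// /crestr.
    by rewrite (nuB x e) ?oppe0//; [exact: measurableI|move=> z [/Be]].
  rewrite (integral_measure_null bf mO pos0 outO).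
  by rewrite (integral_measure_null bf mO neg0 outO) subr0.
rewrite /integral_cm !null ?mulr0 ?addr0//.
- move=> x e B tv mB Be.
  by have [] := total_variation_le0 (measurable_torus_ball x e) mB Be tv.
- move=> x e B tv mB Be.
  by have [] := total_variation_le0 (measurable_torus_ball x e) mB Be tv.
Qed.

End torus_topology.

(** * Characters of the circle and integration on the torus *)

Lemma integral_measure_cst d (T : measurableType d) (R : realType)
    (P : probability T R) (c : R[i]) :
  integral_measure P (fun=> c) = c.
Proof.
case: c => a b.
rewrite /integral_measure !Rintegral_cst// (_ : fine _ = 1) ?mulr1//.
by rewrite -[RHS]/(fine 1%:E); congr fine; exact: probability_setT.
Qed.

Section characters.
Variable R : realType.
Implicit Types (s t : R) (k l : int) (u v : circle R).

Lemma cexpi0 : cexpi 0 = 1 :> R[i].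
Proof. by rewrite /cexpi cos0 sin0. Qed.

Lemma cexpiD s t : cexpi (s + t) = cexpi s * cexpi t.
Proof.
rewrite /cexpi cosD sinD; apply/eqP; rewrite eq_complex/=.
by apply/andP; split; apply/eqP; ring.
Qed.

Lemma cexpiN t : cexpi (- t) = Num.conj (cexpi t).
Proof. by rewrite /cexpi cosN sinN. Qed.

Lemma normr_cexpi t : `|cexpi t| = 1.
Proof. by rewrite normc_def /= cos2Dsin2 sqrtr1. Qed.

Lemma cexpi_2pi k : cexpi (2 * pi * k%:~R) = 1 :> R[i].
Proof.
have nat_2pi (n : nat) : cexpi (2 * pi * n%:R) = 1 :> R[i].
  elim: n => [|n ih]; first by rewrite mulr0 cexpi0.
  rewrite -[n.+1%:R]natr1 mulrDr mulr1 cexpiD ih mul1r /cexpi mulr_natl cos2pi.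
  by rewrite -[pi *+ 2]add0r sinD2pi sin0.
case: k => n; first exact: nat_2pi.
by rewrite NegzE mulrNz mulrN cexpiN nat_2pi rmorph1.
Qed.

Definition circle_char k (t : circle R) : R[i] :=
  cexpi (2 * pi * (k%:~R * cval t)).

(** Removing the integer part of [t] shifts the argument by an integer multiple of 2 pi, so an
    integer frequency does not see the reduction modulo 1. *)
Lemma circle_char_to_circle k t :
  circle_char k (to_circle t) = cexpi (2 * pi * (k%:~R * t)).
Proof.
rewrite /circle_char /=; set n := Num.floor t.
rewrite -[k%:~R * t in RHS](subrK (k%:~R * n%:~R)) [in RHS]mulrDr cexpiD.
by rewrite -mulrBr -[in RHS]intrM cexpi_2pi mulr1.
Qed.

Lemma circle_char0 u : circle_char 0 u = 1.
Proof. by rewrite /circle_char mul0r mulr0 cexpi0. Qed.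

Lemma circle_charD k l u :
  circle_char (k + l) u = circle_char k u * circle_char l u.
Proof. by rewrite /circle_char -cexpiD -mulrDr -mulrDl -intrD. Qed.

Lemma circle_charN k u : circle_char (- k) u = Num.conj (circle_char k u).
Proof. by rewrite /circle_char mulrNz mulNr mulrN cexpiN. Qed.

Lemma circle_char_sub k u v :
  circle_char k (to_circle (cval u - cval v)) =
  circle_char k u * circle_char (- k) v.
Proof.
by rewrite circle_char_to_circle mulrBr mulrBr cexpiD -mulrN -mulNr -mulrNz.
Qed.

Lemma normr_circle_char k u : `|circle_char k u| = 1.
Proof. exact: normr_cexpi. Qed.

Lemma measurable_cos : measurable_fun setT (@cos R).
Proof. by apply: continuous_measurable_fun; exact: continuous_cos. Qed.

Lemma measurable_sin : measurable_fun setT (@sin R).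
Proof. by apply: continuous_measurable_fun; exact: continuous_sin. Qed.

Lemma bounded_mfun_circle_char k : bounded_mfun (circle_char k).
Proof.
have mc : measurable_fun setT (fun t : circle R => 2 * pi * (k%:~R * cval t)).
  by do 2![apply: measurable_funM => //]; exact: measurable_cval.
split.
- exact: (measurableT_comp measurable_cos mc).
- exact: (measurableT_comp measurable_sin mc).
- by exists 1 => t; rewrite normr_circle_char.
Qed.

Let mu01 := uniform_prob (@ltr01 R).

(** Integration against the uniform law is applied to a nonnegative integrand, hence the shift to 1
    + f; the final - 1 takes the shift back. *)
Lemma Rintegral_uniform_FTC (f F : R -> R) : continuous f ->
  (forall x, `|f x| <= 1) -> (forall x : R, is_derive x 1 F (1 + f x)) ->
  \int[mu01]_x f x = F 1 - F 0 - 1.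
Proof.
move=> cf f1 dF.
have mf : measurable_fun setT f by exact: continuous_measurable_fun.
have cf1 : continuous (fun x => 1 + f x).
  by move=> x; apply: cvgD; [exact: cvg_cst|exact: cf].
have intf := integrable_bounded mu01 mf f1.
have int1 : mu01.-integrable setT (EFin \o (fun=> 1 : R)).
  by apply: (@integrable_bounded _ _ _ mu01 _ 1) => // x; rewrite normr1.
have : \int[mu01]_x (1 + f x) = F 1 - F 0.
  rewrite /Rintegral integral_uniform//=; last 2 first.
  - by apply/measurable_EFinP; apply: measurable_funD.
  - move=> x; rewrite lee_fin; have := f1 x; rewrite ler_norml => /andP[h _].
    by rewrite -lerBlDl sub0r.
  rewrite subr0 invr1 mul1e (continuous_FTC2 ltr01 _ _ _ (F := F))//.
  - exact/continuous_subspaceT.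
  - have cF x : {for x, continuous F}.
      by apply: differentiable_continuous; apply/derivable1_diffP; case: (dF x).
    split.
    + by move=> x _; case: (dF x).
    + by apply: cvg_at_right_filter; exact: cF.
    + by apply: cvg_at_left_filter; exact: cF.
  - by move=> x _; rewrite derive1E; case: (dF x).
rewrite RintegralD// Rintegral_cst//= mul1r probability_setT/= => <-.
by rewrite addrC addKr.
Qed.

Lemma integral_circle_char k :
  integral_measure (circle_lebesgue R) (circle_char k) = (k == 0)%:R.
Proof.
have [->|k0] := eqVneq k 0.
  rewrite (_ : circle_char 0 = fun=> 1).
    exact: integral_measure_cst.
  by apply/funext => t; rewrite circle_char0.
have [bre bim _] := bounded_mfun_circle_char k.
(* [circle_lebesgue] is an image law: real integrals over the circle are pulled back to [0, 1], with
   [h] standing for the real or the imaginary part. *)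
have push (h : R[i] -> R) :
    measurable_fun setT (fun u => h (circle_char k u)) ->
    (forall u, `|h (circle_char k u)| <= 1) ->
    \int[circle_lebesgue R]_u h (circle_char k u) =
    \int[mu01]_t h (cexpi (2 * pi * (k%:~R * t))).
  move=> mh h1; rewrite /Rintegral; congr fine.
  rewrite integral_pushforward//.
  - by apply: eq_integral => t _ /=; rewrite circle_char_to_circle.
  - exact/measurable_EFinP.
  - apply: (@integrable_bounded _ _ _ mu01
      (fun t => h (circle_char k (to_circle t))) 1) => //.
    exact: (measurableT_comp mh (@measurable_to_circle R)).
pose a : R := 2 * pi * k%:~R.
have a0 : a != 0.
  by rewrite /a !mulf_neq0// ?intr_eq0//; rewrite gt_eqF// pi_gt0.
have aE t : 2 * pi * (k%:~R * t) = a * t by rewrite /a mulrA.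
(* Since a = 2 pi k, the periodic parts of the antiderivatives below agree at 0 and 1, so only the
   contribution of the shift remains. *)
have [c1 s0] : cos a = 1 /\ sin a = 0.
  by have := cexpi_2pi k; rewrite /cexpi => -[].
have norm1 u : `|circle_char k u| <= 1%:C by rewrite normr_circle_char.
have ca : continuous (fun t : R => a * t).
  by move=> t; apply: cvgMr; exact: cvg_id.
have cosI : \int[mu01]_t cos (a * t) = 0.
  have dF (t : R) : is_derive t 1
      (fun t => t + a^-1 * sin (a * t)) (1 + cos (a * t)).
    apply: is_derive_eq.
    by rewrite /GRing.scale/= mulr1 [_ * a]mulrC mulKf.
  rewrite (Rintegral_uniform_FTC _ _ dF).
  - by rewrite !mulr1 !mulr0 s0 sin0; ring.
  - by move=> t; apply: continuous_comp; [exact: ca|exact: continuous_cos].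
  - by move=> t; rewrite ler_norml cos_geN1 cos_le1.
have sinI : \int[mu01]_t sin (a * t) = 0.
  have dF (t : R) : is_derive t 1
      (fun t => t - a^-1 * cos (a * t)) (1 + sin (a * t)).
    apply: is_derive_eq.
    by rewrite /GRing.scale/= mulr1 mulNr [_ * a]mulrC mulrN mulKf// opprK.
  rewrite (Rintegral_uniform_FTC _ _ dF).
  - by rewrite !mulr1 !mulr0 c1 cos0; ring.
  - by move=> t; apply: continuous_comp; [exact: ca|exact: continuous_sin].
  - by move=> t; rewrite ler_norml sin_geN1 sin_le1.
rewrite /integral_measure !push//; last 2 first.
  - by move=> t; exact: normc_Im_le.
  - by move=> t; exact: normc_Re_le.
rewrite [X in X +i* _](_ : _ = 0) 1?[X in _ +i* X](_ : _ = 0)//.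
- by rewrite -[RHS]sinI; apply: eq_Rintegral => t _; rewrite aE.
- by rewrite -[RHS]cosI; apply: eq_Rintegral => t _; rewrite aE.
Qed.

End characters.

(** * Image laws, product measures and integrals over the torus *)

Section product_integrals.
Variable R : realType.

Lemma integral_measure_distribution d1 d2 (T1 : measurableType d1)
    (T2 : measurableType d2) (P : probability T1 R) (X : {RV P >-> T2})
    (f : T2 -> R[i]) : bounded_mfun f ->
  integral_measure (distribution P X) f = integral_measure P (f \o X).
Proof.
move=> bf; have bfX := bounded_mfun_comp (measurable_funPT X) bf.
have [fr fi _] := bf.
rewrite /integral_measure /Rintegral; congr (fine _ +i* fine _).
- rewrite integral_pushforward//; first exact/measurable_EFinP.
  exact: (integrable_Re P bfX).
- rewrite integral_pushforward//; first exact/measurable_EFinP.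
  exact: (integrable_Im P bfX).
Qed.

Section binary.
Context d1 d2 (T1 : measurableType d1) (T2 : measurableType d2).
Variables (P : probability T1 R) (Q : probability T2 R).
Let PQ : probability (T1 * T2)%type R := (P \x Q)%E.

Lemma integrable_prod (u : T1 -> R) (v : T2 -> R) (M N : R) :
  measurable_fun setT u -> measurable_fun setT v ->
  (forall x, `|u x| <= M) -> (forall x, `|v x| <= N) ->
  PQ.-integrable setT (EFin \o (fun w => u w.1 * v w.2)).
Proof.
move=> mu mv uM vN; apply: (@integrable_bounded _ _ _ PQ _ (M * N)).
  apply: measurable_funM.
    exact: (measurableT_comp mu).
  exact: (measurableT_comp mv).
by move=> w; rewrite normrM ler_pM.
Qed.

Lemma Rintegral_prod (u : T1 -> R) (v : T2 -> R) (M N : R) :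
  measurable_fun setT u -> measurable_fun setT v ->
  (forall x, `|u x| <= M) -> (forall x, `|v x| <= N) ->
  \int[PQ]_w (u w.1 * v w.2) = \int[P]_x u x * \int[Q]_y v y.
Proof.
move=> mu mv uM vN.
have iu := integrable_bounded P mu uM.
have iv := integrable_bounded Q mv vN.
have iw := integrable_prod mu mv uM vN.
rewrite /Rintegral -(integral12_prod_meas1 iw).
transitivity (fine (\int[P]_x ((u x)%:E * (\int[Q]_y v y)%:E))%E).
  congr fine; apply: eq_integral => x _.
  rewrite /fubini_F fineK; last exact: integrable_fin_num.
  by rewrite -integralZl//; apply: eq_integral => y _; rewrite EFinM.
by rewrite integralZr// fineM//; exact: integrable_fin_num.
Qed.

Lemma integral_measure_prod (f : T1 -> R[i]) (g : T2 -> R[i]) :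
  bounded_mfun f -> bounded_mfun g ->
  integral_measure PQ (fun w => f w.1 * g w.2) =
  integral_measure P f * integral_measure Q g.
Proof.
move=> bf bg; have [fr fi [M fM]] := bf; have [gr gi [N gN]] := bg.
have fRM x := normc_Re_le (fM x); have fIM x := normc_Im_le (fM x).
have gRN x := normc_Re_le (gN x); have gIN x := normc_Im_le (gN x).
pose ref x := complex.Re (f x); pose imf x := complex.Im (f x).
pose reg y := complex.Re (g y); pose img y := complex.Im (g y).
have int := integrable_prod; have prod := Rintegral_prod.
apply/eqP; rewrite eq_complex /=; apply/andP; split; apply/eqP.
- transitivity (\int[PQ]_w (ref w.1 * reg w.2) -
    \int[PQ]_w (imf w.1 * img w.2)).
    rewrite -RintegralB;
      [|by []|exact: (int _ _ M N fr gr)|exact: (int _ _ M N fi gi)].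
    by apply: eq_Rintegral => w _; rewrite /ref /reg /imf /img;
      case: (f w.1) (g w.2) => [? ?] [].
  by rewrite (prod _ _ M N fr gr)// (prod _ _ M N fi gi).
- transitivity (\int[PQ]_w (ref w.1 * img w.2) +
    \int[PQ]_w (imf w.1 * reg w.2)).
    rewrite -RintegralD;
      [|by []|exact: (int _ _ M N fr gi)|exact: (int _ _ M N fi gr)].
    by apply: eq_Rintegral => w _; rewrite /ref /reg /imf /img;
      case: (f w.1) (g w.2) => [? ?] [].
  by rewrite (prod _ _ M N fr gi)// (prod _ _ M N fi gr).
Qed.

End binary.

Lemma bounded_mfun_coord (d : nat) (i : 'I_d) (f : circle R -> R[i]) :
  bounded_mfun f -> bounded_mfun (fun z : torus R d => f (tnth z i)).
Proof. by move=> bf; exact: (bounded_mfun_comp (measurable_tnth i) bf). Qed.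

(** The induction follows the recursive definition of [torus_lebesgue]: transfer along [torus_cons],
    then Fubini for the first coordinate against the others. *)
Lemma integral_torus_prod (d : nat) (f : 'I_d -> circle R -> R[i]) :
  (forall i, bounded_mfun (f i)) ->
  integral_measure (torus_lebesgue R d)
    (fun z => \prod_(i < d) f i (tnth z i)) =
  \prod_(i < d) integral_measure (circle_lebesgue R) (f i).
Proof.
elim: d f => [|d ih] f bf.
  rewrite big_ord0 -[RHS](integral_measure_cst (torus_lebesgue R 0)).
  by congr integral_measure; apply/funext => z; rewrite big_ord0.
have bF : bounded_mfun (fun z : torus R d.+1 =>
    \prod_(i < d.+1) f i (tnth z i)).
  by apply: bounded_mfun_prod => i; exact: bounded_mfun_coord.
rewrite [LHS](integral_measure_distribution _ bF).
rewrite big_ord_recl -ih => [|i]; last exact: bf.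
rewrite -integral_measure_prod//; last first.
  by apply: bounded_mfun_prod => i; exact: bounded_mfun_coord.
congr integral_measure; apply/funext => -[p z] /=.
rewrite big_ord_recl; congr (_ * _).
by apply: eq_bigr => i _; congr (f _ _); rewrite !(tnth_nth p).
Qed.

End product_integrals.

(** * Trigonometric polynomials and the Fejer kernel *)

Section trigonometric_polynomials.
Variables (R : realType) (d : nat).
Implicit Types (k l : 'I_d -> int) (x y z : torus R d).

Lemma texp_prod k x : texp k x = \prod_(i < d) circle_char (k i) (tnth x i).
Proof.
by rewrite /texp mulr_sumr (big_morph _ (@cexpiD R) (@cexpi0 R)).
Qed.

Lemma texpD k l x : texp (fun i => k i + l i) x = texp k x * texp l x.
Proof.
rewrite !texp_prod -big_split; apply: eq_bigr => i _; exact: circle_charD.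
Qed.

Lemma texpN k x : texp (fun i => - k i) x = Num.conj (texp k x).
Proof.
rewrite !texp_prod rmorph_prod; apply: eq_bigr => i _; exact: circle_charN.
Qed.

Lemma normr_texp k x : `|texp k x| = 1.
Proof. exact: normr_cexpi. Qed.

Lemma bounded_mfun_texp k : bounded_mfun (texp (R := R) k).
Proof.
rewrite (_ : texp k = fun x => \prod_(i < d) circle_char (k i) (tnth x i)).
  apply: bounded_mfun_prod => i; apply: bounded_mfun_coord.
  exact: bounded_mfun_circle_char.
by apply/funext => x; exact: texp_prod.
Qed.

Lemma integral_texp k :
  integral_measure (torus_lebesgue R d) (texp k) = [forall i, k i == 0]%:R.
Proof.
rewrite (_ : texp k = fun x => \prod_(i < d) circle_char (k i) (tnth x i));
  last by apply/funext => x; exact: texp_prod.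
rewrite (integral_torus_prod (f := fun i => circle_char (k i))); last first.
  by move=> i; exact: bounded_mfun_circle_char.
under eq_bigr do rewrite integral_circle_char.
case: forallP => [k0|/forallP].
  by rewrite big1// => i _; rewrite k0.
by rewrite negb_forall => /existsP[i /negbTE ki]; rewrite (bigD1 i)//= ki mul0r.
Qed.

Lemma integral_texp_mulJ k l :
  integral_measure (torus_lebesgue R d)
    (fun z => texp k z * Num.conj (texp l z)) = [forall i, k i == l i]%:R.
Proof.
rewrite (_ : (fun z => _) = texp (fun i => k i + - l i)); last first.
  by apply/funext => z; rewrite texpD texpN.
rewrite integral_texp; congr (nat_of_bool _)%:R.
by apply: eq_forallb => i; rewrite subr_eq0.
Qed.

Lemma normr2_texp_sum (I : finType) (c : I -> R[i]) (k : I -> 'I_d -> int) z :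
  `|\sum_a c a * texp (k a) z| ^+ 2 =
  \sum_(p : I * I) c p.1 * Num.conj (c p.2) *
    (texp (k p.1) z * Num.conj (texp (k p.2) z)).
Proof.
rewrite normCK rmorph_sum mulr_suml; under eq_bigr do rewrite mulr_sumr.
rewrite pair_big; apply: eq_bigr => -[a b] _ /=.
by rewrite rmorphM; ring.
Qed.

Lemma bounded_mfun_texp_mulJ k l :
  bounded_mfun (fun z : torus R d => texp k z * Num.conj (texp l z)).
Proof.
by apply: bounded_mfunM; [|apply: bounded_mfun_conj]; exact: bounded_mfun_texp.
Qed.

(** In the expanded double sum, orthogonality keeps only pairs of equal frequencies, and injectivity
    of [k] makes these the diagonal pairs. *)
Lemma parseval (I : finType) (c : I -> R[i]) (k : I -> 'I_d -> int) :
  (forall a b, k a =1 k b -> a = b) ->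
  integral_measure (torus_lebesgue R d)
    (fun z => `|\sum_a c a * texp (k a) z| ^+ 2) = \sum_a `|c a| ^+ 2.
Proof.
move=> kI; rewrite (funext (normr2_texp_sum c k)).
rewrite integral_measure_sum; last by move=> p; exact: bounded_mfun_texp_mulJ.
rewrite -(pair_big xpredT xpredT (fun a b => c a * Num.conj (c b) *
  integral_measure (torus_lebesgue R d)
    (fun z => texp (k a) z * Num.conj (texp (k b) z))))/=.
apply: eq_bigr => a _; rewrite (bigD1 a)//= integral_texp_mulJ.
rewrite (_ : [forall i, _] = true) ?mulr1; last by apply/forallP.
rewrite big1 ?addr0 ?normCK// => b ba; rewrite integral_texp_mulJ.
case: forallP => [kab|_]; last by rewrite mulr0.
by move: ba; rewrite (kI a b) ?eqxx// => i; apply/eqP.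
Qed.

Lemma mindex_int_inj n (a b : mindex d n) :
  mindex_int a =1 mindex_int b -> a = b.
Proof. by move=> ab; apply/ffunP => i; apply/val_inj; have [] := ab i. Qed.

Lemma trig_polyM n m (f g : torus R d -> R[i]) :
  trig_poly n f -> trig_poly m g -> trig_poly (n + m) (fun x => f x * g x).
Proof.
move=> [a fE] [b gE].
(* The coefficients of the product are convolutions along this addition. Each sum is at most n + m,
   so [inord] never takes its default value. *)
pose add (p : mindex d n * mindex d m) : mindex d (n + m) :=
  [ffun i => inord (p.1 i + p.2 i)].
exists (fun j => \sum_(p | add p == j) a p.1 * b p.2) => x.
rewrite fE gE mulr_suml; under eq_bigr do rewrite mulr_sumr.
rewrite pair_big (partition_big add xpredT)//=; apply: eq_bigr => k _.
rewrite mulr_suml; apply: eq_bigr => p /eqP <-.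
rewrite mulrACA -texpD; congr (_ * _); congr texp; apply/funext => i.
by rewrite /mindex_int ffunE inordK// ltnS leq_add// -ltnS.
Qed.

End trigonometric_polynomials.

(** * The Fejer kernel as a squared modulus and as a Fourier multiplier *)

Section fejer_kernel.
Variable R : realType.

Lemma sum_int_sym (V : zmodType) (f : int -> V) n :
  \sum_(j < (2 * n).+1) f (j%:Z - n%:Z) =
  \sum_(j < n) f (j%:Z - n%:Z) + \sum_(j < n.+1) f (n%:Z - j%:Z).
Proof.
rewrite -!(big_mkord xpredT (fun j => f (j%:Z - n%:Z))).
rewrite (big_cat_nat (n := n))//=; last by lia.
congr (_ + _); rewrite -{1}[n]add0n big_addn big_mkord.
rewrite (_ : (_ - _)%N = n.+1); last by lia.
rewrite (reindex_inj rev_ord_inj)/=; apply: eq_bigr => i _; congr f.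
by have := ltn_ord i; lia.
Qed.

(** Each difference h with |h| <= n comes from exactly n + 1 - |h| pairs; the induction enlarges the
    square of pairs by one row and one column. *)
Lemma sum_int_diff (V : zmodType) (f : int -> V) n :
  \sum_(k < n.+1) \sum_(l < n.+1) f (k%:Z - l%:Z) =
  \sum_(j < (2 * n).+1) f (j%:Z - n%:Z) *+ (n.+1 - `|(j%:Z - n%:Z)%R|).
Proof.
elim: n => [|n ih].
  by rewrite muln0 !big_ord1 subrr.
(* The new row and column together produce every difference from -(n+1) to n+1 exactly once. *)
transitivity (
    \sum_(j < (2 * n).+1) f (j%:Z - n%:Z) *+ (n.+1 - `|(j%:Z - n%:Z)%R|) +
    (f (- n.+1%:Z) + \sum_(j < (2 * n).+1) f (j%:Z - n%:Z) + f n.+1%:Z)).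
  rewrite big_ord_recr/=; under eq_bigr do rewrite big_ord_recr/=.
  rewrite big_split/= ih -!addrA; congr (_ + _).
  rewrite sum_int_sym big_ord_recl [X in _ + X]big_ord_recl sub0r subr0 -!addrA.
  congr (_ + _); rewrite [X in _ = _ + X]addrC; congr (_ + _).
    by apply: eq_bigr => i _; congr f; rewrite lift0; lia.
  by congr (_ + _); apply: eq_bigr => i _; congr f; rewrite lift0; lia.
(* In the sum for n + 1, the two extreme differences have multiplicity 1, and every inner
   multiplicity exceeds the one for n by 1. *)
rewrite (_ : (2 * n.+1).+1 = (2 * n).+3); last by lia.
rewrite [RHS]big_ord_recl [X in _ = _ + X]big_ord_recr/=.
have -> : (n.+2 - `|((ord0 : 'I_(2 * n).+3)%:Z - n.+1%:Z)%R|)%N = 1%N.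
  by rewrite /=; lia.
rewrite mulr1n sub0r -!addrA [LHS]addrCA; congr (_ + _).
rewrite addrA -big_split/=; congr (_ + _).
  apply: eq_bigr => j _; rewrite -mulrSr.
  have -> : (bump 0 j)%:Z - n.+1%:Z = j%:Z - n%:Z by rewrite /bump; lia.
  by congr (f _ *+ _); have := ltn_ord j; lia.
have -> : (bump 0 (2 * n).+1)%:Z - n.+1%:Z = n.+1%:Z by rewrite /bump; lia.
by rewrite (_ : (_ - _)%N = 1%N)//; lia.
Qed.

Let weight n (k : int) : R[i] := 1 - `|k|%:~R / n.+1%:R.

Lemma fejer1_sqr n (u : circle R) :
  n.+1%:R * fejer1 n u = `|\sum_(k < n.+1) circle_char k u| ^+ 2.
Proof.
rewrite normCK rmorph_sum mulr_suml.
transitivity (\sum_(k < n.+1) \sum_(l < n.+1) circle_char (k%:Z - l%:Z) u).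
  rewrite (sum_int_diff (fun k => circle_char k u)) /fejer1 mulr_sumr.
  apply: eq_bigr => j _; set k := j%:Z - n%:Z.
  (* This bound makes the truncated subtraction in the multiplicity a true one. *)
  have kn : (`|k| <= n)%N by rewrite /k; have := ltn_ord j; lia.
  rewrite -/(circle_char k u) mulrA -[RHS]mulr_natl; congr (_ * _).
  by rewrite natrB 1?ltnW ?ltnS// mulrBr mulr1 -natr_absz mulrCA divff ?mulr1//.
apply: eq_bigr => k _; rewrite mulr_sumr; apply: eq_bigr => l _.
by rewrite circle_charD circle_charN.
Qed.

Lemma fejer1_sub n (u t : circle R) :
  fejer1 n (to_circle (cval u - cval t)) = \sum_(j < (2 * n).+1)
    (weight n (j%:Z - n%:Z) * circle_char (j%:Z - n%:Z) u) *
    circle_char (- (j%:Z - n%:Z)) t.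
Proof.
rewrite /fejer1; apply: eq_bigr => j _.
rewrite -[cexpi _]/(circle_char (j%:Z - n%:Z) (to_circle (cval u - cval t))).
by rewrite circle_char_sub mulrA.
Qed.

Lemma bounded_mfun_fejer1_sub n (u : circle R) :
  bounded_mfun (fun t => fejer1 n (to_circle (cval u - cval t))).
Proof.
rewrite (funext (fejer1_sub n u)); apply: bounded_mfun_sum => j.
apply: bounded_mfunM; first exact: bounded_mfun_cst.
exact: bounded_mfun_circle_char.
Qed.

(** Expanding the kernel, orthogonality leaves the single term of frequency [k], with its Fejer
    weight. *)
Lemma integral_fejer1 n (u : circle R) (k : int) : `|k| <= n%:Z ->
  integral_measure (circle_lebesgue R)
    (fun t => fejer1 n (to_circle (cval u - cval t)) * circle_char k t) =
  (1 - `|k|%:~R / n.+1%:R) * circle_char k u.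
Proof.
move=> kn; pose i (j : 'I_(2 * n).+1) := j%:Z - n%:Z.
rewrite (_ : (fun t => _) = fun t => \sum_(j < (2 * n).+1)
    (weight n (i j) * circle_char (i j) u) * circle_char (k - i j) t);
  last first.
  apply/funext => t; rewrite fejer1_sub mulr_suml; apply: eq_bigr => j _.
  by rewrite /i [circle_char (k - _) t]circle_charD; ring.
rewrite integral_measure_sum; last by move=> j; exact: bounded_mfun_circle_char.
(* The surviving index is j = k + n, in range because |k| <= n; the absolute value only turns this
   nonnegative integer into a natural number. *)
have j0P : (`|(k + n%:Z)%R| < (2 * n).+1)%N by lia.
have ij0 : i (Ordinal j0P) = k by rewrite /i /=; lia.
rewrite (bigD1 (Ordinal j0P))//= ij0 integral_circle_char subrr eqxx mulr1.
rewrite big1 ?addr0// => j jj0; rewrite integral_circle_char subr_eq0.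
case: eqP => [kij|_]; last by rewrite mulr0.
by move: jj0; rewrite -(inj_eq val_inj)/= => /eqP[]; move: kij; rewrite /i; lia.
Qed.

Section torus.
Variable d : nat.
Implicit Types (y z u : torus R d).

Lemma texp_sub (k : 'I_d -> int) y z :
  texp k (torus_sub y z) = texp k y * Num.conj (texp k z).
Proof.
rewrite -texpN !texp_prod -big_split; apply: eq_bigr => i _.
by rewrite tnth_mktuple circle_char_sub.
Qed.

(** The one-variable identities are multiplied, and the product of sums is expanded into a sum over
    multi-indices. *)
Lemma fejer_sqr n u :
  (n.+1 ^ d)%:R * fejer n u =
  `|\sum_(k : mindex d n) texp (mindex_int k) u| ^+ 2.
Proof.
rewrite /fejer natrX -[d in _ ^+ d]card_ord -prodr_const -big_split/=.
under eq_bigr do rewrite fejer1_sqr.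
rewrite prodrXl -normr_prod.
rewrite (bigA_distr_bigA (fun i (k : 'I_n.+1) => circle_char k (tnth u i))).
by congr (`|_| ^+ 2); apply: eq_bigr => k _; rewrite texp_prod.
Qed.

Lemma torus_conv_texp n y (k : 'I_d -> int) : (forall i, `|k i| <= n%:Z) ->
  torus_conv (@fejer R d n) (texp k) y =
  (\prod_(i < d) (1 - `|k i|%:~R / n.+1%:R)) * texp k y.
Proof.
move=> kn; rewrite /torus_conv texp_prod -big_split/=.
under [RHS]eq_bigr do rewrite -integral_fejer1//.
rewrite -integral_torus_prod; last first.
  move=> i; apply: bounded_mfunM; first exact: bounded_mfun_fejer1_sub.
  exact: bounded_mfun_circle_char.
congr integral_measure; apply/funext => z.
rewrite texp_prod -big_split; apply: eq_bigr => i _.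
by rewrite tnth_mktuple.
Qed.

End torus.

End fejer_kernel.

(** * Left singular vectors and the moment matrix *)

Lemma sum_enum_val (V : nmodType) (I : finType) (F : I -> V) :
  \sum_(j < #|I|) F (enum_val j) = \sum_i F i.
Proof.
rewrite [RHS](reindex_onto enum_val enum_rank)/=; last first.
  by move=> i _; exact: enum_rankK.
by rewrite [RHS](eq_bigl xpredT) => [|j] //; rewrite enum_valK eqxx.
Qed.

Section linear_algebra.
Local Open Scope sesquilinear_scope.
Variable C : numClosedFieldType.

Lemma sum_CauchySchwarz (I : finType) (a b : I -> C) :
  `|\sum_i a i * Num.conj (b i)| ^+ 2 <=
  (\sum_i `|a i| ^+ 2) * (\sum_i `|b i| ^+ 2).
Proof.
pose row (f : I -> C) := \row_(j < #|I|) f (enum_val j).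
have dotE f g : dotmx (row f) (row g) = \sum_i f i * Num.conj (g i).
  rewrite dotmxE mxE -(sum_enum_val (fun i => f i * Num.conj (g i))).
  by apply: eq_bigr => j _; rewrite !mxE.
have normE f : dotmx (row f) (row f) = \sum_i `|f i| ^+ 2.
  by rewrite dotE; apply: eq_bigr => i _; rewrite normCK.
have [+ _] := CauchySchwarz (@dotmx C #|I|) (row a) (row b).
by rewrite /= dotE !normE.
Qed.

Variable n : nat.
Implicit Types (U : 'M[C]_n) (x w : 'rV[C]_n).

Lemma unitary_dot U x w : U \is unitarymx ->
  \sum_j (x *m U) 0 j * Num.conj ((w *m U) 0 j) =
  \sum_j x 0 j * Num.conj (w 0 j).
Proof.
have dotE (u v : 'rV[C]_n) : dotmx u v = \sum_j u 0 j * Num.conj (v 0 j).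
  by rewrite dotmxE mxE; apply: eq_bigr => j _; rewrite !mxE.
move=> Uu; rewrite -!dotE !dotmxE trmx_mul map_mxM mulmxA.
by rewrite mulmxtVK.
Qed.

Lemma unitary_norm U x : U \is unitarymx ->
  \sum_j `|(x *m U) 0 j| ^+ 2 = \sum_j `|x 0 j| ^+ 2.
Proof.
move=> Uu; under eq_bigr do rewrite normCK.
by rewrite unitary_dot//; apply: eq_bigr => j _; rewrite normCK.
Qed.

(** As [w *m U] vanishes before [r], the product of [x] and [w] only involves the later coordinates
    of [x *m U]. Cauchy-Schwarz bounds their square norm from below, and unitarity gives the
    total. *)
Lemma unitary_tail_bound U x w r : U \is unitarymx ->
  (forall j : 'I_n, (j < r)%N -> (w *m U) 0 j = 0) ->
  0 < \sum_j `|w 0 j| ^+ 2 ->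
  \sum_(j < n | (j < r)%N) `|(x *m U) 0 j| ^+ 2 <=
  \sum_j `|x 0 j| ^+ 2 -
  `|\sum_j x 0 j * Num.conj (w 0 j)| ^+ 2 / \sum_j `|w 0 j| ^+ 2.
Proof.
move=> Uu wr0 wpos.
pose tail (j : 'I_n) := if (j < r)%N then 0 else (x *m U) 0 j.
have -> : \sum_j `|x 0 j| ^+ 2 = \sum_(j < n | (j < r)%N) `|(x *m U) 0 j| ^+ 2 +
    \sum_j `|tail j| ^+ 2.
  rewrite -(unitary_norm x Uu).
  rewrite (bigID (fun j : 'I_n => (j < r)%N))/=; congr (_ + _).
  rewrite [RHS](bigID (fun j : 'I_n => (j < r)%N))/=.
  rewrite [X in _ = X + _]big1 ?add0r.
    by apply: eq_bigr => j /negbTE jr; rewrite /tail jr.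
  by move=> j jr; rewrite /tail jr normr0 expr0n.
rewrite -addrA lerDl subr_ge0 ler_pdivrMr//.
rewrite -(unitary_norm w Uu) -(unitary_dot x w Uu).
apply: le_trans (sum_CauchySchwarz _ _); rewrite le_eqVlt; apply/orP; left.
apply/eqP; congr (`|_| ^+ 2); apply: eq_bigr => j _.
by rewrite /tail; case: ifP => // jr; rewrite wr0// conjC0 !mulr0.
Qed.

End linear_algebra.

(** * Polynomials vanishing on the support and the left kernel of the moment matrix *)

Section moment_matrix.
Local Open Scope sesquilinear_scope.
Variable R : realType.

(** Cancelling the unitary V^* in w A = 0 leaves w U D = 0 with D diagonal, and the diagonal entries
    of index below the rank are nonzero. *)
Lemma svd_left_kernel (N : nat) (A U V : 'M[R[i]]_N) (s : 'rV[R]_N)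
    (w : 'rV[R[i]]_N) : is_svd A U s V -> w *m A = 0 ->
  forall j : 'I_N, (j < \rank A)%N -> (w *m U) 0 j = 0.
Proof.
move=> [Uu Vu s0 sdecr AE] wA j jr.
set D := diag_mx _ in AE.
(* If s_j were 0, monotonicity would kill all entries from j on; then D = [pid_mx j *m D] would give
   A rank at most j. *)
have sj : s 0 j != 0.
  apply/eqP => sj0; move: jr; rewrite ltnNge => /negP; apply.
  have DE : D = pid_mx j *m D.
    apply/matrixP => a b; rewrite !mxE (bigD1 a)//= big1 => [|i ia].
      rewrite !mxE eqxx addr0; have [aj|ja] := ltnP a j; first by rewrite mul1r.
      rewrite mul0r; suff -> : s 0 a = 0 by rewrite mul0rn.
      by apply/eqP; rewrite eq_le s0 -sj0 sdecr.
    rewrite !mxE; case: (@eqP _ (a : nat) i) => [/val_inj ai|_];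
      last by rewrite mul0r.
    by rewrite ai eqxx in ia.
  rewrite AE (leq_trans (mxrankM_maxl _ _))// (leq_trans (mxrankM_maxr _ _))//.
  rewrite DE (leq_trans (mxrankM_maxl _ _))//.
  by rewrite rank_pid_mx// ltnW.
have wUD : w *m U *m D = 0.
  have wAE : w *m U *m D *m V^t* = w *m A by rewrite AE !mulmxA.
  by rewrite -[LHS](mulmxKtV _ Vu erefl) wAE wA mul0mx.
move/rowP: wUD => /(_ j); rewrite mul_mx_diag !mxE => /eqP.
by rewrite mulf_eq0 fmorph_eq0 (negbTE sj) orbF => /eqP.
Qed.

Variable d : nat.
Implicit Types (x y z : torus R d).

Lemma bounded_mfun_trig_poly N (p : torus R d -> R[i]) :
  trig_poly N p -> bounded_mfun p.
Proof.
move=> [c pE]; rewrite (funext pE); apply: bounded_mfun_sum => k.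
by apply: bounded_mfunM; [exact: bounded_mfun_cst|exact: bounded_mfun_texp].
Qed.

Lemma card_mindex N : #|{: mindex d N}| = (N.+1 ^ d)%N.
Proof. by rewrite card_ffun !card_ord. Qed.

(** The positivity of [W] is also concluded because it later yields that of the Fejer convolution at
    [y]. *)
Lemma p1_le (mu : complex_measure (torus R d) R) N y (p : torus R d -> R[i])
    (U V : 'M[R[i]]_(msize d N)) (s : 'rV[R]_(msize d N)) :
  trig_poly N p -> (forall x, cm_supp mu x -> p x = 0) -> p y != 0 ->
  is_svd (moment_mx mu N) U s V ->
  let W := integral_measure (torus_lebesgue R d) (fun z => `|p z| ^+ 2) in
  0 < W /\ p1 mu U y <= 1 - `|p y| ^+ 2 / ((N.+1 ^ d)%:R * W).
Proof.
move=> pN p0 py svd W; have [c pE] := pN.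
have WE : W = \sum_k `|c k| ^+ 2.
  rewrite /W (funext pE) parseval// => a b; exact: mindex_int_inj.
have W0 : 0 < W.
  rewrite WE lt_neqAle sumr_ge0 ?andbT => [|k _]; last by rewrite exprn_ge0.
  apply: contra py; rewrite eq_sym psumr_eq0 => [/allP c0|k _];
    last by rewrite exprn_ge0.
  rewrite pE big1// => k _.
  by have := c0 k (mem_index_enum k); rewrite sqrf_eq0 normr_eq0 => /eqP->;
     rewrite mul0r.
split=> //.
pose e : 'rV[R[i]]_(msize d N) := (evec N y)^t*.
(* This row is c^*; the conjugation in the inner product with [e] restores c, so that product equals
   p(y). *)
pose w : 'rV[R[i]]_(msize d N) := \row_a Num.conj (c (enum_val a)).
have eE a : e 0 a = texp (mindex_int (enum_val a)) y.
  by rewrite !mxE texpN conjCK.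
have wT : w *m moment_mx mu N = 0.
  apply/rowP => b; rewrite !mxE.
  under eq_bigr do rewrite !mxE /fourier_coef.
  rewrite -integral_cm_sum; last by move=> a; exact: bounded_mfun_texp.
  (* The entry of c^* T_N at a multi-index l is the integral of conj(p) e(lx), whose integrand
     vanishes on the support. *)
  rewrite (_ : (fun x => _) = fun x =>
    Num.conj (p x) * texp (mindex_int (enum_val b)) x).
    apply: integral_cm_supp => [|x /p0->]; last by rewrite conjC0 mul0r.
    apply: bounded_mfunM; last exact: bounded_mfun_texp.
    by apply: bounded_mfun_conj; exact: bounded_mfun_trig_poly pN.
  apply/funext => x; rewrite pE rmorph_sum mulr_suml.
  rewrite -(sum_enum_val (fun k => Num.conj (c k * texp (mindex_int k) x) *
    texp (mindex_int (enum_val b)) x)).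
  apply: eq_bigr => a _; rewrite rmorphM /= -texpN -mulrA -texpD; congr (_ * _).
  by congr texp; apply/funext => i; rewrite opprB addrC.
have [Uu _ _ _ _] := svd.
have wW : \sum_j `|w 0 j| ^+ 2 = W.
  rewrite WE -(sum_enum_val (fun k => `|c k| ^+ 2)).
  by apply: eq_bigr => a _; rewrite mxE norm_conjC.
have eN : \sum_j `|e 0 j| ^+ 2 = (N.+1 ^ d)%:R.
  under eq_bigr do rewrite eE normr_texp expr1n.
  by rewrite sumr_const card_ord -card_mindex.
have ewp : \sum_j e 0 j * Num.conj (w 0 j) = p y.
  rewrite pE -(sum_enum_val (fun k => c k * texp (mindex_int k) y)).
  by apply: eq_bigr => a _; rewrite eE mxE conjCK mulrC.
have := @unitary_tail_bound _ _ U e w _ Uu (svd_left_kernel svd wT).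
rewrite wW ewp eN => /(_ W0) tail.
have N0 : 0 < (N.+1 ^ d)%:R :> R[i] by rewrite ltr0n expn_gt0.
rewrite /p1 mulrC ler_pdivrMr// mulrBl mul1r (le_trans tail)// lerD2l lerN2.
by rewrite invfM mulrA [leLHS]mulrAC mulfVK ?gt_eqF.
Qed.

End moment_matrix.

(** * Approximation by the Fejer kernel *)

(** Weierstrass' product inequality, by induction. It serves both the Fejer weights and, with equal
    factors, Bernoulli's bound on (n+1)^d / (n+m+1)^d. *)
Lemma prod_one_sub_bounds (K : numDomainType) (I : Type) (s : seq I)
    (t : I -> K) :
  (forall i, 0 <= t i <= 1) ->
  [/\ 0 <= \prod_(i <- s) (1 - t i), \prod_(i <- s) (1 - t i) <= 1 &
      1 - \sum_(i <- s) t i <= \prod_(i <- s) (1 - t i)].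
Proof.
move=> t01; elim: s => [|i s [p0 p1 sp]]; first by rewrite !big_nil subr0 ler01.
have /andP[ti0 ti1] := t01 i; rewrite !big_cons; split.
- by rewrite mulr_ge0 ?subr_ge0.
- by rewrite mulr_ile1 ?subr_ge0// lerBlDr lerDl.
- rewrite mulrBl mul1r opprD addrCA addrC lerB//.
  by rewrite -[leRHS]mulr1 ler_wpM2l.
Qed.

Section fejer_approximation.
Variables (R : realType) (d : nat).
Implicit Types (y z : torus R d) (g : torus R d -> R[i]).

Lemma bounded_mfun_fejer_sub n y :
  bounded_mfun (fun z : torus R d => fejer n (torus_sub y z)).
Proof.
apply: bounded_mfun_prod => i.
rewrite (_ : (fun _ => _) =
  fun z : torus R d =>
    fejer1 n (to_circle (cval (tnth y i) - cval (tnth z i)))).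
  exact: bounded_mfun_coord (bounded_mfun_fejer1_sub n (tnth y i)).
by apply/funext => z; rewrite tnth_mktuple.
Qed.

Lemma bounded_mfun_normr2 dT (T : measurableType dT) (f : T -> R[i]) :
  bounded_mfun f -> bounded_mfun (fun x => `|f x| ^+ 2).
Proof.
move=> bf; rewrite (funext (fun x => normCK (f x))).
by apply: bounded_mfunM => //; exact: bounded_mfun_conj.
Qed.

Lemma L2norm_sqr g : (L2norm g)%:C ^+ 2 =
  integral_measure (torus_lebesgue R d) (fun z => `|g z| ^+ 2).
Proof.
have gE z : `|g z| ^+ 2 = (Normc.normc (g z) ^+ 2)%:C by rewrite rmorphXn.
rewrite -rmorphXn /= /L2norm sqr_sqrtr; last first.
  by apply: Rintegral_ge0 => z _; exact: sqr_ge0.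
rewrite (funext gE) /integral_measure/=; congr (_ +i* _).
by rewrite Rintegral_cst// mul0r.
Qed.

(** The frequencies of |g|^2 are differences of multi-indices, bounded by m <= n, so convolution
    multiplies each by an explicit weight [W p] within dm/(n+1) of 1. *)
Lemma fejer_approx m n g y : (m <= n)%N -> trig_poly m g ->
  `|torus_conv (@fejer R d n) (fun z => `|g z| ^+ 2) y - `|g y| ^+ 2| <=
  (d * m)%:R / n.+1%:R * ((m.+1 ^ d)%:R * (L2norm g)%:C ^+ 2).
Proof.
move=> mn [c gE].
pose k (p : mindex d m * mindex d m) i := mindex_int p.1 i - mindex_int p.2 i.
have kE p z : texp (k p) z =
    texp (mindex_int p.1) z * Num.conj (texp (mindex_int p.2) z).
  by rewrite -texpN -texpD.
have km p i : `|k p i| <= m%:Z.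
  rewrite /k /mindex_int.
  by have := ltn_ord (p.1 i); have := ltn_ord (p.2 i); lia.
pose cc p := c p.1 * Num.conj (c p.2).
have g2E z : `|g z| ^+ 2 = \sum_p cc p * texp (k p) z.
  by rewrite gE normr2_texp_sum; apply: eq_bigr => p _; rewrite kE.
pose W p : R[i] := \prod_(i < d) (1 - `|k p i|%:~R / n.+1%:R).
have convE : torus_conv (@fejer R d n) (fun z => `|g z| ^+ 2) y =
    \sum_p cc p * (W p * texp (k p) y).
  rewrite /torus_conv.
  rewrite (_ : (fun z => _) =
      fun z => \sum_p cc p * (fejer n (torus_sub y z) * texp (k p) z));
    last first.
    apply/funext => z; rewrite g2E mulr_sumr.
    by apply: eq_bigr => p _; rewrite mulrCA.
  rewrite integral_measure_sum => [|p]; last first.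
    apply: bounded_mfunM; first exact: bounded_mfun_fejer_sub.
    exact: bounded_mfun_texp.
  apply: eq_bigr => p _; congr (_ * _); apply: torus_conv_texp => i.
  by rewrite (le_trans (km p i))// lez_nat.
have n0 : 0 < n.+1%:R :> R[i] by rewrite ltr0n.
have W1 p : `|W p - 1| <= (d * m)%:R / n.+1%:R.
  have t01 i : 0 <= (`|k p i|%:~R : R[i]) / n.+1%:R <= 1.
    rewrite divr_ge0 ?ler0z ?ler0n// ler_pdivrMr// mul1r.
    rewrite -[n.+1%:R]/(n.+1%:Z%:~R) ler_int (le_trans (km p i))// lez_nat.
    by rewrite (leq_trans mn).
  have [_ Wle1 Wge] := prod_one_sub_bounds (index_enum 'I_d) t01.
  rewrite ler0_norm ?subr_le0// opprB lerBlDr -lerBlDl.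
  apply: le_trans Wge; rewrite lerD2l lerN2.
  apply: (@le_trans _ _ (\sum_(i < d) m%:R / n.+1%:R)); last first.
    by rewrite sumr_const card_ord -[leLHS]mulr_natl mulrA -natrM.
  apply: ler_sum => i _.
  rewrite ler_pM2r ?invr_gt0// -[m%:R]/(m%:Z%:~R) ler_int; exact: km.
rewrite convE g2E -sumrB (le_trans (ler_norm_sum _ _ _))//.
have L2E : (L2norm g)%:C ^+ 2 = \sum_a `|c a| ^+ 2.
  by rewrite L2norm_sqr (funext gE) parseval// => a b; exact: mindex_int_inj.
apply: (@le_trans _ _ (\sum_(p : mindex d m * mindex d m)
    (d * m)%:R / n.+1%:R * (`|c p.1| * `|c p.2|))).
  apply: ler_sum => p _; rewrite -mulrBr -[X in _ - X]mul1r -mulrBl.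
  by rewrite !normrM norm_conjC normr_texp mulr1 mulrC ler_wpM2r// mulr_ge0.
rewrite -mulr_sumr ler_wpM2l//.
rewrite -(pair_big xpredT xpredT (fun a b => `|c a| * `|c b|))/=.
under eq_bigr do rewrite -mulr_sumr.
rewrite -mulr_suml -expr2 L2E -card_mindex.
(* Cauchy-Schwarz against the constant 1 costs the number (m+1)^d of coefficients. *)
have := @sum_CauchySchwarz _ _ (fun=> 1) (fun a : mindex d m => `|c a|).
under eq_bigr do rewrite mul1r conj_normC.
under [X in _ <= X * _]eq_bigr do rewrite normr1 expr1n.
under [X in _ <= _ * X]eq_bigr do rewrite normr_id.
by rewrite sumr_const ger0_norm// sumr_ge0.
Qed.

End fejer_approximation.

(* The inequalities are between elements of R[i]: there, a <= b means that a and
   b have the same imaginary part and that Re a <= Re b. *)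
Theorem theorem3p8 (R : realType) (d m : nat) (hd : (0 < d)%N) (hm : (0 < m)%N)
    (mu : complex_measure (torus R d) R) (hmu : in_calM mu)
    (y : torus R d) (g : torus R d -> R[i]) (hg : trig_poly m g)
    (hgy : g y != 0) (hsupp : forall x, cm_supp mu x -> g x = 0)
    (n : nat) (hn : (0 < n)%N) (hmn : (m <= n)%N)
    (U V : 'M[R[i]]_(msize d (n + m))) (s : 'rV[R]_(msize d (n + m)))
    (hsvd : is_svd (moment_mx mu (n + m)) U s V) :
  p1 mu U y <=
    1 - (n.+1 ^ d)%:R / ((n + m).+1 ^ d)%:R
        * (`|g y| ^+ 2 / torus_conv (@fejer R d n) (fun x => `|g x| ^+ 2) y)
  /\
  1 - (n.+1 ^ d)%:R / ((n + m).+1 ^ d)%:R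
      * (`|g y| ^+ 2 / torus_conv (@fejer R d n) (fun x => `|g x| ^+ 2) y)
  <= (L2norm g)%:C ^+ 2 / `|g y| ^+ 2 * ((m * (4 * m + 2) ^ d)%:R / n.+1%:R)
     + (d * m)%:R / (n + m).+1%:R.
Proof.
pose M : R[i] := (n.+1 ^ d)%:R; pose N : R[i] := ((n + m).+1 ^ d)%:R.
pose K := torus_conv (@fejer R d n) (fun x => `|g x| ^+ 2) y.
pose q (x : torus R d) : R[i] :=
  \sum_(k : mindex d n)
    Num.conj (texp (mindex_int k) y) * texp (mindex_int k) x.
have M0 : 0 < M by rewrite ltr0n expn_gt0.
have N0 : 0 < N by rewrite ltr0n expn_gt0.
have H0 : 0 < `|g y| ^+ 2 by rewrite exprn_gt0 ?normr_gt0.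
have qy : q y = M.
  rewrite /q (eq_bigr (fun=> 1)) => [|k _]; last first.
    by rewrite mulrC -normCK normr_texp expr1n.
  by rewrite sumr_const card_mindex.
have qfejer z : `|q z| ^+ 2 = M * fejer n (torus_sub y z).
  (* The conjugate of q(z) is the sum of the e(k(y - z)), so [fejer_sqr] applies at y - z. *)
  rewrite fejer_sqr -norm_conjC /q rmorph_sum; congr (`|_| ^+ 2).
  by apply: eq_bigr => k _; rewrite rmorphM/= conjCK texp_sub mulrC.
have qgpoly : trig_poly (n + m) (fun x => q x * g x).
  by apply: trig_polyM hg; exists (fun k => Num.conj (texp (mindex_int k) y)).
have qgsupp x : cm_supp mu x -> q x * g x = 0 by move=> /hsupp->; rewrite mulr0.
have qgy : q y * g y != 0 by rewrite mulf_neq0// qy gt_eqF.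
have WE :
    integral_measure (torus_lebesgue R d) (fun z => `|q z * g z| ^+ 2) = M * K.
  rewrite /K /torus_conv -integral_measureZ; last first.
    apply: bounded_mfunM; first exact: bounded_mfun_fejer_sub.
    exact/bounded_mfun_normr2/bounded_mfun_trig_poly/hg.
  by congr integral_measure; apply/funext => z;
    rewrite normrM exprMn qfejer mulrA.
have [] := p1_le qgpoly qgsupp qgy hsvd.
rewrite WE pmulr_rgt0// => K0 p1le; rewrite -/M -/N -/K.
split.
  apply: le_trans p1le _; rewrite lerD2l lerN2 -/N.
  rewrite normrM exprMn qy (ger0_norm (ltW M0)).
  by rewrite le_eqVlt; apply/orP; left; apply/eqP; field; rewrite !gt_eqF.
set H := `|g y| ^+ 2 in H0 *; set L := _ ^+ 2.
have NE : 1 - (d * m)%:R / (n + m).+1%:R <= M / N <= 1.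
  (* With t = m/(n+m+1), the factor 1 - t is (n+1)/(n+m+1). *)
  pose t (i : 'I_d) : R[i] := m%:R / (n + m).+1%:R.
  have nm0 : 0 < (n + m).+1%:R :> R[i] by rewrite ltr0n.
  have t01 i : 0 <= t i <= 1.
    rewrite divr_ge0 ?ler0n// ler_pdivrMr// mul1r ler_nat.
    by rewrite (leq_trans (leq_addl n m)).
  have [_ + +] := prod_one_sub_bounds (index_enum 'I_d) t01.
  rewrite /t sumr_const prodr_const card_ord.
  have -> : 1 - m%:R / (n + m).+1%:R = n.+1%:R / (n + m).+1%:R :> R[i].
    by rewrite -{1}(divff (lt0r_neq0 nm0)) -mulrBl -addSn natrD addrK.
  rewrite expr_div_n -!natrX -/M -/N => -> h; rewrite andbT (le_trans _ h)//.
  by rewrite lerD2l lerN2 -[leLHS]mulr_natl mulrA natrM.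
have /andP[NE1 NE2] := NE.
have A0 : 0 <= M / N by rewrite divr_ge0 ?ltW.
have approx := fejer_approx y hmn hg; rewrite -/K -/H -/L in approx.
have L0 : 0 <= L by rewrite exprn_ge0// lecR sqrtr_ge0.
have main : 1 - H / K <= L / H * ((m * (4 * m + 2) ^ d)%:R / n.+1%:R).
  (* If K >= H, then (K - H)/K <= (K - H)/H; otherwise 1 - H/K is at most 0. *)
  apply: (@le_trans _ _ (`|K - H| / H)).
    have KHr : K - H \is Num.real by rewrite realB// ger0_real ?ltW.
    rewrite -{1}(divff (lt0r_neq0 K0)) -mulrBl.
    have [KH|KH] := real_leP (real0 _) KHr.
      by rewrite ger0_norm// ler_wpM2l// lef_pV2 ?posrE// -subr_ge0.
    apply: (@le_trans _ _ 0); last by rewrite divr_ge0// ltW.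
    by rewrite nmulr_rle0// invr_ge0 ltW.
  rewrite ler_pdivrMr// (le_trans approx)//.
  rewrite (_ : L / H * _ * H = L * ((m * (4 * m + 2) ^ d)%:R / n.+1%:R));
    last first.
    by rewrite mulrAC mulfVK ?gt_eqF.
  rewrite (_ : _ / _ * _ = L * ((d * m * m.+1 ^ d)%:R / n.+1%:R)); last first.
    by rewrite [in RHS]natrM; ring.
  rewrite ler_wpM2l// ler_pM2r ?invr_gt0 ?ltr0n// ler_nat.
  rewrite mulnAC mulnC leq_mul2l; apply/orP; right.
  (* The constant absorbs d (m+1)^d, since d <= 2^d and m + 1 <= 2m + 1. *)
  rewrite (_ : 4 * m + 2 = 2 * (2 * m).+1)%N; last by lia.
  by rewrite expnMn leq_mul// ?leq_exp2r//; [exact/ltnW/ltn_expl|lia].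
(* The loss splits into the volume ratio, giving dm/(n+m+1), and the Fejer error, whose factor M/N
   <= 1 is dropped. *)
apply: (@le_trans _ _ ((1 - M / N) + M / N * (1 - H / K))).
  by rewrite mulrBr mulr1 addrA subrK.
rewrite addrC lerD//; last by rewrite lerBlDl -lerBlDr.
set B := L / H * _ in main *.
have B0 : 0 <= B by rewrite mulr_ge0// divr_ge0 ?ler0n// ltW.
by rewrite (le_trans (ler_wpM2l A0 main))// ler_piMl.
Qed.
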